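(* Let $\vec H$ be a DAG with $\ell$ edges. Then $\mathrm{dtd}(\vec H)\le\lfloor \ell/5\rfloor+3$.
   Context: For a DAG $\vec H$, a source is a vertex of in-degree $0$. A DAG elimination forest of a DAG $\vec H$ is defined recursively: if $\vec H$ is empty, it is the empty forest; if the underlying undirected graph of $\vec H$ is disconnected, it is the union of DAG elimination forests (trees) of its connected components; if the underlying graph is connected and $\vec H$ has exactly one source $s$, it is the single-node tree $s$; otherwise (connected, at least two sources) it is a tree whose root is an arbitrarily chosen source $s$ of $\vec H$ and whose subtrees are the trees of a DAG elimination forest of the DAG obtained from $\vec H$ by deleting $s$ and all vertices reachable from $s$. The depth of a rooted forest is the maximum number of nodes on a root-to-leaf path. $\mathrm{dtd}(\vec H)$ is the minimum depth of a DAG elimination forest of $\vec H$. *)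

(* Defs.v *)
From Stdlib Require List.
From mathcomp Require Import all_boot.
Set Implicit Arguments. Unset Strict Implicit. Unset Printing Implicit Defensive.

Section DagElim.
Variable V : finType.
Variable e : rel V.

(* a (simple) DAG: no directed cycle (in particular no loops) *)
Definition dag : Prop := forall x y, e x y -> ~~ connect e y x.

Definition num_edges : nat := #|[set p : V * V | e p.1 p.2]|.

Definition urel (S : {set V}) : rel V :=
  [rel x y | [&& x \in S, y \in S & e x y || e y x]].
Definition drel (S : {set V}) : rel V :=
  [rel x y | [&& x \in S, y \in S & e x y]].

Definition connected_sub (S : {set V}) : Prop :=
  S != set0 /\ forall x y, x \in S -> y \in S -> connect (urel S) x y.

Definition comp (S : {set V}) (x : V) : {set V} :=
  [set y in S | connect (urel S) x y].
Definition is_component (S C : {set V}) : Prop :=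
  exists2 x, x \in S & C = comp S x.

Definition sources (S : {set V}) : {set V} :=
  [set v in S | [forall u in S, ~~ e u v]].

Definition reach (S : {set V}) (s : V) : {set V} :=
  [set y in S | connect (drel S) s y].

Inductive tree : Type := Node of V & seq tree.

Fixpoint tdepth (t : tree) : nat :=
  match t with Node _ ts => (foldr (fun u m => maxn (tdepth u) m) 0 ts).+1 end.

Definition fdepth (F : seq tree) : nat := foldr maxn 0 (map tdepth F).

Inductive DAG_elim : {set V} -> seq tree -> Prop :=
| DE_empty : DAG_elim set0 [::]
| DE_disconnected (S : {set V}) (Ts : seq ({set V} * tree)) :
    S != set0 -> ~ connected_sub S ->
    uniq (map fst Ts) ->
    (forall C, C \in map fst Ts <-> is_component S C) ->
    (forall p, List.In p Ts -> DAG_elim p.1 [:: p.2]) ->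
    DAG_elim S (map snd Ts)
| DE_one_source (S : {set V}) (s : V) :
    connected_sub S -> sources S = [set s] ->
    DAG_elim S [:: Node s [::]]
| DE_many_sources (S : {set V}) (s : V) (F : seq tree) :
    connected_sub S -> s \in sources S -> 1 < #|sources S| ->
    DAG_elim (S :\: reach S s) F ->
    DAG_elim S [:: Node s F].

End DagElim.

(* Main.v *)
(* Remove a source whose reach meets at least 5 edges as long as there is one.
   Afterwards every reach meets at most 4 edges; removing any source then leaves
   components that all have a source s1 whose reach meets at most 3 edges. In
   such a component with at least 5 edges, take a maximal connected out-closed
   set T containing s1, a union of reaches, that meets at most 4 edges. All edges
   entering T have the same head a, so removing a source s outside T that reaches
   a cuts what is left of T from the rest. The former has at most 4 edges, hence
   depth at most 2, and the rest has lost the at least 5 edges met by T and the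
   reach of s. *)
Require Import Defs.
From mathcomp Require Import all_boot.
From mathcomp Require Import zify.

Set Implicit Arguments. Unset Strict Implicit. Unset Printing Implicit Defensive.

Lemma uniq_leq_card (T : finType) (l : seq T) (A : {set T}) :
  uniq l -> all (fun x => x \in A) l -> size l <= #|A|.
Proof.
by move=> /card_uniqP <- /allP sub; apply/subset_leq_card/subsetP.
Qed.

Lemma ltn_divn5 m n : m + 5 <= n -> m %/ 5 < n %/ 5.
Proof. lia. Qed.

Section Elimination.
Variables (V : finType) (e : rel V).
Implicit Types (S T U C R X : {set V}) (s t u v w x y z : V) (F : seq (tree V)).

(** * Edge sets and edge counts *)

Definition edges S : {set V * V} :=
  [set p | [&& p.1 \in S, p.2 \in S & e p.1 p.2]].

(* For T closed under out-neighbours, these are the edges of S incident to T. *)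
Definition edges_into S T : {set V * V} := [set p in edges S | p.2 \in T].

Definition out_closed S T := forall x y, x \in T -> y \in S -> e x y -> y \in T.

Definition tree_depth_le S k :=
  exists2 t, DAG_elim e S [:: t] & tdepth t <= k.

Lemma edgesS S T : S \subset T -> edges S \subset edges T.
Proof.
move=> /subsetP sST; apply/subsetP=> -[x y]; rewrite !inE /=.
by case/and3P=> /sST-> /sST-> ->.
Qed.

Lemma in_edges_into S T x y :
  ((x, y) \in edges_into S T) = [&& x \in S, y \in S, e x y & y \in T].
Proof. by rewrite !inE /= -!andbA. Qed.

Lemma edges_intoS S T S' T' :
  S \subset S' -> T \subset T' -> edges_into S T \subset edges_into S' T'.
Proof.
move=> /subsetP sS /subsetP sT; apply/subsetP=> -[x y]; rewrite !in_edges_into.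
by case/and4P=> /sS-> /sS-> -> /sT.
Qed.

(** As [C] avoids [T], no edge inside [C] has its head in [T]. Every loss of edges after a removal
    is counted this way. *)
Lemma card_edges_setD S T C : C \subset S :\: T ->
  #|edges C| + #|edges_into S T| <= #|edges S|.
Proof.
move=> sC; rewrite -(cardsID (edges_into S T) (edges S)) addnC.
apply: leq_add; apply/subset_leq_card/subsetP=> -[x y].
  by rewrite !inE /= => /andP[-> ->].
rewrite !inE /= => /and3P[/(subsetP sC) + /(subsetP sC) + ->].
by rewrite !inE => /andP[_ ->] /andP[/negbTE-> ->]; rewrite andbF.
Qed.

(** * Undirected and directed connectivity *)

Lemma urel_sym S : symmetric (urel e S).
Proof. by move=> x y; rewrite /urel /= andbCA orbC. Qed.

Lemma connect_urelC S x y : connect (urel e S) x y = connect (urel e S) y x.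
Proof. exact/sym_connect_sym/urel_sym. Qed.

Lemma connect_urelS S T x y : S \subset T ->
  connect (urel e S) x y -> connect (urel e T) x y.
Proof.
move=> /subsetP sST; apply: connect_sub => u v /and3P[uS vS euv].
by apply: connect1; rewrite /urel /= !sST.
Qed.

Lemma connect_drelS S T x y : S \subset T ->
  connect (drel e S) x y -> connect (drel e T) x y.
Proof.
move=> /subsetP sST; apply: connect_sub => u v /and3P[uS vS euv].
by apply: connect1; rewrite /drel /= !sST.
Qed.

Lemma connect_ind (r : rel V) (P : V -> Prop) x y :
  (forall u v, P u -> r u v -> P v) -> connect r x y -> P x -> P y.
Proof.
move=> clP /connectP[p rp ->]; elim: p x rp => //= z p IHp x /andP[rxz rp] Px.
by apply: IHp rp _; apply: clP rxz.
Qed.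

(** The edge is the first step of the path that leaves [X]. *)
Lemma connected_cut S X x y : connect (urel e S) x y -> x \in X -> y \notin X ->
  exists u v, [/\ u \in S :&: X, v \in S :\: X & e u v || e v u].
Proof.
move=> /connectP[p + ->]; elim: p x => /= [|z p IHp] x; first by move=> _ ->.
move=> /andP[/and3P[xS zS exz] rp] xX yX.
have [zX|zX] := boolP (z \in X); first exact: IHp rp zX yX.
by exists x, z; rewrite !inE xS xX zS zX.
Qed.

(** * Reaches, sources and components *)

Lemma reach_sub S s : reach e S s \subset S.
Proof. by apply/subsetP=> x; rewrite inE => /andP[]. Qed.

Lemma mem_reach S s : s \in S -> s \in reach e S s.
Proof. by move=> sS; rewrite inE sS connect0. Qed.

Lemma reach_out_closed S s : out_closed S (reach e S s).
Proof.
move=> x y; rewrite !inE => /andP[xS csx] yS exy; rewrite yS.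
by apply: connect_trans csx (connect1 _); rewrite /drel /= xS yS.
Qed.

Lemma reachS S T s : S \subset T -> reach e S s \subset reach e T s.
Proof.
move=> sST; apply/subsetP=> x; rewrite !inE => /andP[/(subsetP sST)-> ].
exact: connect_drelS.
Qed.

Lemma reach_min S T s : out_closed S T -> s \in T -> reach e S s \subset T.
Proof.
move=> clT sT; apply/subsetP=> x; rewrite inE => /andP[_ csx].
apply: (connect_ind (P := fun z => z \in T)) csx sT => u v uT /and3P[_ vS euv].
exact: clT euv.
Qed.

Lemma reach_pred S s y : s \in S -> y \in reach e S s -> y != s ->
  exists2 p, p \in reach e S s & e p y.
Proof.
move=> sS; rewrite inE => /andP[_ /connectP[p + ->]].
elim/last_ind: p => [_|p z _]; first by rewrite eqxx.
rewrite last_rcons rcons_path => /andP[rp /and3P[lS _ elz]] _.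
exists (last s p) => //; rewrite inE lS; apply/connectP; by exists p.
Qed.

Lemma reach_connected S s y : s \in S -> y \in reach e S s ->
  connect (urel e (reach e S s)) s y.
Proof.
move=> sS; rewrite inE => /andP[_ csy].
pose P z := z \in reach e S s /\ connect (urel e (reach e S s)) s z.
suff: P y by case.
apply: connect_ind csy _; last by split; [apply: mem_reach | apply: connect0].
move=> u v [uR csu] /and3P[_ vS euv].
have vR := reach_out_closed uR vS euv.
split=> //; apply: connect_trans csu (connect1 _).
by rewrite /urel /= uR vR euv.
Qed.

Lemma sourcesP S s :
  reflect (s \in S /\ forall u, u \in S -> ~~ e u s) (s \in sources e S).
Proof.
by rewrite inE; apply: (iffP andP) => -[-> /forall_inP].
Qed.

Lemma source_sub S s : s \in sources e S -> s \in S.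
Proof. by case/sourcesP. Qed.

Lemma comp_facts U C : is_component e U C ->
  [/\ C \subset U, connected_sub e C &
      forall x y, x \in C -> y \in U -> e x y || e y x -> y \in C].
Proof.
case=> x0 x0U ->; set C0 := Defs.comp e U x0.
have x0C : x0 \in C0 by rewrite inE x0U connect0.
have sCU : C0 \subset U by apply/subsetP=> x; rewrite inE => /andP[].
have cl x y : x \in C0 -> y \in U -> e x y || e y x -> y \in C0.
  rewrite !inE => /andP[xU cx] yU exy; rewrite yU.
  by apply: connect_trans cx (connect1 _); rewrite /urel /= xU yU.
have c0 y : y \in C0 -> connect (urel e C0) x0 y.
  rewrite inE => /andP[_ cy].
  pose P z := z \in C0 /\ connect (urel e C0) x0 z.
  suff: P y by case.
  apply: connect_ind cy _ => // u v [uC cu] /and3P[_ vU euv].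
  have vC := cl _ _ uC vU euv.
  split=> //; apply: connect_trans cu (connect1 _).
  by rewrite /urel /= uC vC.
split=> //; split; first by apply/set0Pn; exists x0.
move=> x y xC yC; apply: connect_trans (c0 _ yC).
by rewrite connect_urelC; apply: c0.
Qed.

(** By connectedness some edge of [S] leaves [C]. Its other end lies in [R] because [C] is a whole
    component of the rest, and it points into [R] because [R] is out-closed. *)
Lemma component_entry S R C r : connected_sub e S -> R \subset S -> r \in R ->
  out_closed S R -> is_component e (S :\: R) C ->
  exists x y, [/\ x \in C, y \in R & e x y].
Proof.
move=> [_ cS] sRS rR clR /comp_facts[sC [/set0Pn[c cC] _] clC].
have sCS x : x \in C -> x \in S by move=> /(subsetP sC); rewrite inE => /andP[].
have rC : r \notin C by apply/negP=> /(subsetP sC); rewrite inE rR.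
have [x [y []]] := connected_cut (cS _ _ (sCS _ cC) (subsetP sRS _ rR)) cC rC.
rewrite !inE => /andP[xS xC] /andP[yC yS] exy.
have yR : y \in R.
  by apply: contraNT yC => yR; apply: clC exy; rewrite // inE yR.
exists x, y; split=> //; case/orP: exy => // eyx.
have := subsetP sC _ xC; rewrite inE => /andP[/negP[]].
exact: clR eyx.
Qed.

Lemma source_out_edge S s t : connected_sub e S -> s \in sources e S ->
  t \in S -> t != s -> exists2 c, c \in S & e s c.
Proof.
move=> [_ cS] /sourcesP[sS src] tS nts.
have [||u [c []]] := connected_cut (X := [set s]) (cS _ _ sS tS); rewrite ?inE //.
move=> /andP[uS /eqP->] /andP[_ cS'] /orP[esc|ecs]; first by exists c.
by have := src _ cS'; rewrite ecs.
Qed.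

(** * Assembling elimination trees from components *)

Lemma connected_subP S :
  reflect (connected_sub e S)
    ((S != set0) && [forall x in S, forall y in S, connect (urel e S) x y]).
Proof.
apply: (iffP andP) => -[nS cS]; split=> //.
  by move=> x y xS yS; have /forall_inP/(_ y yS) := forall_inP cS x xS.
by apply/forall_inP=> x xS; apply/forall_inP=> y; apply: cS.
Qed.

Lemma forest_of_trees k (l : seq {set V}) :
  (forall C, C \in l -> tree_depth_le C k) ->
  exists Ts : seq ({set V} * tree V),
    [/\ map fst Ts = l, forall p, List.In p Ts -> DAG_elim e p.1 [:: p.2]
      & fdepth (map snd Ts) <= k].
Proof.
elim: l => [|C l IHl] Hl; first by exists [::].
have [|Ts [<- HTs dTs]] := IHl; first by move=> D Dl; apply: Hl; rewrite inE Dl orbT.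
have [|t Ht dt] := Hl C; first by rewrite inE eqxx.
exists ((C, t) :: Ts); split=> //=; last by rewrite /fdepth /= geq_max dt.
by move=> p [<-|/HTs].
Qed.

Lemma forest_of_components S k :
  (forall C, is_component e S C -> tree_depth_le C k) ->
  exists F, DAG_elim e S F /\ fdepth F <= k.
Proof.
move=> HC; have [->|nS] := eqVneq S set0.
  by exists [::]; split=> //; apply: DE_empty.
have [cS|cS] := connected_subP S.
  have [x xS] := set0Pn _ nS.
  have [|t Ht dt] := HC S.
    exists x => //; apply/setP=> y; rewrite inE.
    by case: (boolP (y \in S)) => // yS; rewrite (proj2 cS).
  by exists [:: t]; rewrite /fdepth /= maxn0.
have [|Ts [eTs HTs dTs]] := @forest_of_trees k (enum [set Defs.comp e S x | x in S]).
  by move=> C; rewrite mem_enum => /imsetP[x xS ->]; apply: HC; exists x.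
exists (map snd Ts); split=> //; apply: DE_disconnected => //.
  by rewrite eTs enum_uniq.
move=> C; rewrite eTs mem_enum; split=> [/imsetP[x xS ->]|[x xS ->]].
  by exists x.
exact: imset_f.
Qed.

Lemma tree_of_source S s : connected_sub e S -> sources e S = [set s] ->
  tree_depth_le S 1.
Proof. by move=> cS sS; exists (Node s [::]) => //; apply: DE_one_source. Qed.

Lemma tree_depth_leW S k k' : k <= k' -> tree_depth_le S k -> tree_depth_le S k'.
Proof. by move=> kk' [t Ht dt]; exists t => //; apply: leq_trans dt kk'. Qed.

(** This also covers a single source, where the definition forces a lone node: its depth 1 is within
    [k.+1]. *)
Lemma tree_remove_source S s k : connected_sub e S -> s \in sources e S ->
  (forall C, is_component e (S :\: reach e S s) C -> tree_depth_le C k) ->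
  tree_depth_le S k.+1.
Proof.
move=> cS sS HC; have [le1|gt1] := leqP #|sources e S| 1.
  apply: (@tree_depth_leW _ 1) => //; apply: (@tree_of_source _ s) => //.
  by apply/esym/eqP; rewrite eqEcard sub1set sS cards1.
have [F [HF dF]] := forest_of_components HC.
exists (Node s F); first exact: DE_many_sources.
by rewrite /= ltnS; move: dF; rewrite /fdepth foldr_map.
Qed.

(** * Acyclicity, and sets with few edges *)

Hypothesis e_dag : dag e.

(** Among the vertices reaching [v], take one with the largest reach. An in-neighbour would have a
    strictly larger reach, since there is no cycle. *)
Lemma source_above S v : v \in S ->
  exists2 s, s \in sources e S & v \in reach e S s.
Proof.
move=> vS; pose P u := (u \in S) && (v \in reach e S u).
have Pv : P v by rewrite /P vS mem_reach.
case: (arg_maxnP (fun u => #|reach e S u|) Pv) => s /andP[sS vs] smax.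
exists s => //; apply/sourcesP; split=> // u uS; apply/negP=> eus.
have sRu : s \in reach e S u by apply: (reach_out_closed _ sS eus); apply: mem_reach.
have sub : reach e S s \subset reach e S u.
  apply: reach_min => //; exact: reach_out_closed.
have Pu : P u by rewrite /P uS (subsetP sub).
have /negP[] : ~~ (#|reach e S s| < #|reach e S u|) by rewrite -leqNgt; apply: smax.
apply/proper_card; rewrite properE sub; apply/subsetPn; exists u.
  exact: mem_reach.
apply/negP; rewrite inE => /andP[_ csu]; have /negP[] := e_dag eus.
by apply: connect_sub csu => x y /and3P[_ _ exy]; apply: connect1.
Qed.

(* Remove a source meeting the most edges: a remaining component with two
   sources would have two edges, and one of its sources would meet three. *)
Lemma tree_depth_few_edges S : connected_sub e S -> #|edges S| <= 4 ->
  tree_depth_le S 2.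
Proof.
move=> cS m4; have [x0 x0S] := set0Pn _ (proj1 cS).
have [s0 s0S _] := source_above x0S.
case: (arg_maxnP (fun u => #|edges_into S (reach e S u)|) s0S) => s sS smax.
apply: (tree_remove_source cS sS) => C HC.
have [sC cC clC] := comp_facts HC.
have sCS : C \subset S by apply: subset_trans sC (subsetDl _ _).
have [x [r [xC rR exr]]] := component_entry cS (reach_sub S s)
  (mem_reach (source_sub sS)) (@reach_out_closed S s) HC.
have [t tC xt] := source_above xC.
have [le1|gt1] := leqP #|sources e C| 1.
  apply: (@tree_of_source _ t) => //.
  by apply/esym/eqP; rewrite eqEcard sub1set tC cards1.
have tt' : exists2 t', t' \in sources e C & t' != t.
  move: gt1; rewrite (cardsD1 t) tC => /card_gt0P[t']; rewrite in_setD1.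
  by case/andP=> ? ?; exists t'.
have {tt'} [t' t'C nt] := tt'.
have [c cC' etc] := source_out_edge cC tC (source_sub t'C) nt.
have [c' c'C' et'c'] : exists2 c', c' \in C & e t' c'.
  by apply: (source_out_edge cC t'C (source_sub tC)); rewrite eq_sym.
have [sS' CS] := (source_sub sS, subsetP sCS).
have rS := subsetP (reach_sub S s) _ rR.
have nCR z : z \in C -> z \notin reach e S s.
  by move=> /(subsetP sC); rewrite in_setD => /andP[].
have nrs : r != s.
  apply: contraTneq exr => ->; case/sourcesP: sS => _; apply; exact: CS.
have [p pR epr] := reach_pred sS' rR nrs.
have pS := subsetP (reach_sub S s) _ pR.
have mC2 : 2 <= #|edges C|.
  apply: (@uniq_leq_card _ [:: (t, c); (t', c')]).
    by rewrite /= inE xpair_eqE eq_sym (negbTE nt).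
  by rewrite /= !inE /= cC' etc c'C' et'c' (source_sub tC) (source_sub t'C).
have xtS : x \in reach e S t by apply: (subsetP (reachS _ sCS)).
have rtS : r \in reach e S t by apply: reach_out_closed xtS rS exr.
have tS := CS _ (source_sub tC).
have ctS : c \in reach e S t.
  exact: (reach_out_closed (mem_reach tS) (CS _ cC') etc).
(* The edge from [x] to [r] enters the removed reach, the one from [p] to [r] lies inside it, and
   the one from [t] to [c] lies in [C]. *)
have e3 : 3 <= #|edges_into S (reach e S t)|.
  apply: (@uniq_leq_card _ [:: (x, r); (p, r); (t, c)]).
    rewrite /= !inE !xpair_eqE !negb_or !negb_and.
    have -> : x != p by apply: contraTneq pR => <-; apply: nCR.
    have -> : r != c by apply: contraTneq rR => ->; apply: nCR.
    by rewrite !orbT.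
  by rewrite /= !in_edges_into (CS _ xC) (CS _ cC') pS rS tS exr epr etc rtS ctS.
(* An in-neighbour of [t] in the removed reach would pull [t] into it; any other would lie in
   [C]. *)
have tSs : t \in sources e S.
  apply/sourcesP; split=> // u uS; apply/negP=> eut.
  have [uR|uR] := boolP (u \in reach e S s).
    by have /negP[] := nCR _ (source_sub tC); apply: reach_out_closed uR tS eut.
  have uC : u \in C.
    by apply: clC (source_sub tC) _ _; rewrite ?eut ?orbT // in_setD uR.
  by case/sourcesP: tC => _ /(_ u uC); rewrite eut.
(* By the choice of [s], its reach also meets at least 3 edges, and these are disjoint from the 2
   edges of [C]. *)
suff: 5 <= #|edges S| by rewrite ltnNge m4.
apply: leq_trans (card_edges_setD sC); apply: leq_add mC2 (leq_trans e3 _).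
exact: smax.
Qed.

(** * Clusters and the edges entering them *)

(** Together with out-closedness, [cluster_pred] says locally that, for acyclic [e], [T] is a union
    of reaches of sources of [S]. *)
Record cluster S s1 T : Prop := Cluster {
  cluster_sub : T \subset S;
  cluster_out_closed : out_closed S T;
  cluster_root : s1 \in T;
  cluster_connect : forall y, y \in T -> connect (urel e T) s1 y;
  cluster_pred : forall y, y \in T -> y \in sources e S \/ exists2 u, u \in T & e u y
}.

Lemma cluster_reach S s1 : s1 \in sources e S -> cluster S s1 (reach e S s1).
Proof.
move=> s1S; have s1S' := source_sub s1S.
split; [exact: reach_sub | exact: reach_out_closed | exact: mem_reach | |].
  by move=> y; apply: reach_connected.
move=> y yR; have [->|ny] := eqVneq y s1; first by left.
by right; apply: reach_pred ny.
Qed.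

Lemma clusterU S s1 T s a : cluster S s1 T -> s \in sources e S ->
  a \in T -> a \in reach e S s -> cluster S s1 (T :|: reach e S s).
Proof.
move=> [sT clT s1T cT pT] sS aT aR; have sS' := source_sub sS.
split.
- by rewrite subUset sT reach_sub.
- move=> x y; rewrite !in_setU => /orP[xT|xR] yS exy.
    by rewrite (clT x).
  by rewrite (reach_out_closed xR) ?orbT.
- by rewrite in_setU s1T.
- move=> y; rewrite in_setU => /orP[/cT|yR]; first exact/connect_urelS/subsetUl.
  apply: connect_trans (connect_urelS (subsetUl _ _) (cT _ aT)) _.
  apply: connect_urelS (subsetUr _ _) _.
  by apply: connect_trans (reach_connected _ yR); rewrite // connect_urelC reach_connected.
move=> y; rewrite in_setU => /orP[/pT[|[u uT euy]]|yR]; [by left| |].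
  by right; exists u; rewrite ?in_setU ?uT.
have [->|ny] := eqVneq y s; first by left.
by have [p pR epy] := reach_pred sS' yR ny; right; exists p; rewrite ?in_setU ?pR ?orbT.
Qed.

(* If the reach of [s1] missed the head [a], connectedness of [T] would give a
   vertex [z] of that reach with in-neighbours in [T] on both sides, and with
   the edges entering at [a] and [b] this makes five edges. *)
Lemma cluster_head_reach S s1 T x y a b : cluster S s1 T ->
  s1 \in sources e S -> #|edges_into S T| <= 4 ->
  x \in S :\: T -> y \in S :\: T -> a \in T -> b \in T -> e x a -> e y b ->
  a != b -> a \in reach e S s1.
Proof.
move=> [sT clT s1T cT pT] s1S m4.
rewrite !in_setD => /andP[xT xS] /andP[yT yS] aT bT exa eyb nab.
apply: contraLR m4 => aR; rewrite -ltnNge.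
have s1S' := source_sub s1S; have TS := subsetP sT.
have [u uT eua] : exists2 u, u \in T & e u a.
  by case: (pT _ aT) => // /sourcesP[_ /(_ x xS)]; rewrite exa.
have [z [w []]] := connected_cut (cT _ aT) (mem_reach s1S') aR.
rewrite in_setI in_setD => /andP[zT zR] /andP[wR wT] ezw.
have {ezw} ewz : e w z.
  case/orP: ezw => // ezw; case/negP: wR; exact: reach_out_closed zR (TS _ wT) ezw.
have nz : z != s1.
  by apply: contraTneq ewz => ->; case/sourcesP: s1S => _; apply; apply: TS.
have [p pR epz] := reach_pred s1S' zR nz.
have pT' : p \in T by apply: (subsetP (reach_min clT s1T)).
have naz : a != z by apply: contraNneq aR => ->.
have nwp : w != p by apply: contraNneq wR => ->.
have nT v v' : v \notin T -> v' \in T -> v != v'.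
  by move=> vT; apply: contraTneq => <-.
apply: (@uniq_leq_card _ [:: (x, a); (u, a); (w, z); (p, z); (y, b)]).
  rewrite /= !inE !xpair_eqE !negb_or !negb_and naz nab nwp.
  (* [z] may equal [b], so [(w, z)] and [(p, z)] are told apart from [(y, b)] by their tails, of
     which only [y] is outside [T]. *)
  have [xu wy py] : [/\ x != u, w != y & p != y].
    by rewrite !(eq_sym _ y); split; apply: nT.
  by rewrite xu wy py !orbT.
by rewrite /= !in_edges_into xS yS !TS // exa eua ewz epz eyb aT bT zT.
Qed.

(** Distinct heads would both lie in the reach of [s1]. Each has an in-neighbour inside [T] besides
    the one outside, which makes four edges into that reach. *)
Lemma cluster_unique_head S s1 T x y a b : cluster S s1 T ->
  s1 \in sources e S -> #|edges_into S (reach e S s1)| <= 3 ->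
  #|edges_into S T| <= 4 ->
  x \in S :\: T -> y \in S :\: T -> a \in T -> b \in T -> e x a -> e y b ->
  a = b.
Proof.
move=> clu s1S m3 m4 xST yST aT bT exa eyb; apply: contraTeq m3 => nab.
rewrite -ltnNge.
have aR := cluster_head_reach clu s1S m4 xST yST aT bT exa eyb nab.
have bR : b \in reach e S s1.
  by apply: (cluster_head_reach clu s1S m4 yST xST bT aT eyb exa); rewrite eq_sym.
have [[sT _ _ _ pT] TS] := (clu, subsetP (cluster_sub clu)).
move: xST yST; rewrite !in_setD => /andP[xT xS] /andP[yT yS].
have [u uT eua] : exists2 u, u \in T & e u a.
  by case: (pT _ aT) => // /sourcesP[_ /(_ x xS)]; rewrite exa.
have [w wT ewb] : exists2 w, w \in T & e w b.
  by case: (pT _ bT) => // /sourcesP[_ /(_ y yS)]; rewrite eyb.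
have nT v v' : v \notin T -> v' \in T -> v != v'.
  by move=> vT; apply: contraTneq => <-.
apply: (@uniq_leq_card _ [:: (x, a); (u, a); (y, b); (w, b)]).
  have [xu yw] : x != u /\ y != w by split; apply: nT.
  by rewrite /= !inE !xpair_eqE !negb_or !negb_and nab xu yw !orbT.
by rewrite /= !in_edges_into xS yS !TS // exa eua ewb eyb aR bR.
Qed.

(** Keep adding the reach of a source above the tail of an entering edge. This must overshoot, as
    [T] cannot exhaust [S] with at most 4 edges. *)
Lemma maximal_cluster S s1 T : connected_sub e S -> 4 < #|edges S| ->
  cluster S s1 T -> #|edges_into S T| <= 4 ->
  exists T' s x a, [/\ cluster S s1 T', #|edges_into S T'| <= 4,
    s \in sources e S, [/\ x \in S :\: T', a \in T', a \in reach e S s & e x a]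
    & 4 < #|edges_into S (T' :|: reach e S s)|].
Proof.
move=> cS m5; have [n] := ubnP (#|S| - #|T|); elim: n T => // n IHn T ltn clu m4.
have [sT clT s1T cT pT] := clu.
have [v vS vT] : exists2 v, v \in S & v \notin T.
  apply/subsetPn; apply: contraTN m4 => sST; rewrite -ltnNge.
  apply: leq_trans m5 _; apply/subset_leq_card/subsetP=> -[x y].
  by rewrite in_edges_into inE => /= /and3P[-> yS ->]; rewrite yS (subsetP sST).
have [a [x []]] := connected_cut (proj2 cS _ _ (subsetP sT _ s1T) vS) s1T vT.
rewrite in_setI => /andP[aS aT] xST /orP[eax|exa].
  move: xST; rewrite in_setD => /andP[/negP xT xS].
  by case: xT; apply: clT eax.
have xS : x \in S by move: xST; rewrite in_setD => /andP[].
have [s sS xR] := source_above xS.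
have aR : a \in reach e S s by apply: reach_out_closed xR aS exa.
have [m4'|] := leqP #|edges_into S (T :|: reach e S s)| 4; last by exists T, s, x, a.
apply: (IHn (T :|: reach e S s)) => //; last exact: clusterU aR.
rewrite -ltnS; apply: leq_trans ltn; rewrite ltnS; apply: ltn_sub2l.
  by apply: proper_card; rewrite properE sT; apply/subsetPn; exists v.
apply: proper_card; rewrite properE subsetUl; apply/subsetPn; exists x.
  by rewrite in_setU xR orbT.
by move: xST; rewrite in_setD => /andP[].
Qed.

(** * Light sets and the depth bounds *)

(** All vertices are quantified, since a source of a subset need not be a source of [S]. *)
Definition light S := forall v, v \in S -> #|edges_into S (reach e S v)| <= 4.

Lemma lightS S T : T \subset S -> light S -> light T.
Proof.
move=> sTS lS v vT; apply: leq_trans (lS v (subsetP sTS _ vT)).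
by apply/subset_leq_card/edges_intoS => //; apply: reachS.
Qed.

(* The edge joining a component to the removed reach is lost. *)
Lemma light_component S s C : connected_sub e S -> light S -> s \in S ->
  is_component e (S :\: reach e S s) C ->
  exists2 t, t \in sources e C & #|edges_into C (reach e C t)| <= 3.
Proof.
move=> cS lS sS HC; have [sC cC clC] := comp_facts HC.
have sCS : C \subset S by apply: subset_trans sC (subsetDl _ _).
have [x [r [xC rR exr]]] := component_entry cS (reach_sub S s)
  (mem_reach sS) (@reach_out_closed S s) HC.
have [t tC xt] := source_above xC; exists t => //.
have tS := subsetP sCS _ (source_sub tC).
have [xS rS] := (subsetP sCS _ xC, subsetP (reach_sub _ _) _ rR).
have xtS : x \in reach e S t by apply: (subsetP (reachS _ sCS)).
rewrite -ltnS; apply: leq_trans (lS t tS); apply: proper_card.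
rewrite properE edges_intoS ?reachS //; apply/subsetPn; exists (x, r).
  by rewrite in_edges_into xS rS exr (reach_out_closed xtS).
rewrite in_edges_into; apply/negP=> /and4P[_ /(subsetP sC)].
by rewrite in_setD rR.
Qed.

Lemma tree_depth_light S s1 : connected_sub e S -> light S ->
  s1 \in sources e S -> #|edges_into S (reach e S s1)| <= 3 ->
  tree_depth_le S (#|edges S| %/ 5 + 2).
Proof.
have [n] := ubnP #|edges S|; elim: n S s1 => // n IHn S s1 ltn cS lS s1S m3.
have [m4|m5] := leqP #|edges S| 4.
  by apply: tree_depth_leW (tree_depth_few_edges cS m4); lia.
have [T [s [x [a [clu m4 sS [xST aT aR exa] m5']]]]] :=
  maximal_cluster cS m5 (cluster_reach s1S) (leqW m3).
have [sT clT s1T _ _] := clu.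
apply: (@tree_depth_leW _ (#|edges S| %/ 5 + 1).+1); first by lia.
apply: (tree_remove_source cS sS) => C HC; have [sC cC clC] := comp_facts HC.
have sCS : C \subset S by apply: subset_trans sC (subsetDl _ _).
have [sCT|nCT] := boolP (C \subset T).
  (* With at least 5 edges in [S] the quotient is positive, so the remaining budget is at least
     2. *)
  apply: (@tree_depth_leW _ 2); first by lia.
  apply: tree_depth_few_edges => //; apply: leq_trans m4.
  apply/subset_leq_card/subsetP=> -[u v]; rewrite inE in_edges_into /=.
  by case/and3P=> /(subsetP sCS)-> vC ->; rewrite (subsetP sCS _ vC) (subsetP sCT).
(* An edge of [C] crossing the boundary of [T] would enter [T] at its only head [a], which was
   removed with the reach of [s]. *)
have dCT : [disjoint C & T].
  apply/pred0Pn => -[z /andP[/= zC zT]].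
  have [w wC wT] := subsetPn nCT.
  have [u [v []]] := connected_cut (proj2 cC _ _ zC wC) zT wT.
  rewrite in_setI in_setD => /andP[uC uT] /andP[vT vC] /orP[euv|evu].
    by case/negP: vT; apply: clT euv; rewrite // (subsetP sCS).
  have vST : v \in S :\: T by rewrite in_setD vT (subsetP sCS).
  have au := cluster_unique_head clu s1S m3 m4 xST vST aT uT exa evu.
  by have := subsetP sC _ uC; rewrite in_setD -au aR.
have sC' : C \subset S :\: (T :|: reach e S s).
  by rewrite setDUr subsetI sC subsetD sCS dCT.
have mC : #|edges C| + 5 <= #|edges S|.
  by apply: leq_trans (card_edges_setD sC'); rewrite leq_add2l.
have [t tC t3] := light_component cS lS (source_sub sS) HC.
apply: tree_depth_leW (IHn _ _ _ cC (lightS sCS lS) tC t3).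
  by rewrite addn2 addn1 !ltnS ltn_divn5.
by rewrite -ltnS; apply: leq_trans ltn; rewrite ltnS -addn1 (leq_trans _ mC) ?leq_add2l.
Qed.

Lemma tree_depth_connected S : connected_sub e S ->
  tree_depth_le S (#|edges S| %/ 5 + 3).
Proof.
have [n] := ubnP #|edges S|; elim: n S => // n IHn S ltn cS.
rewrite addnS.
have [/exists_inP[v vS m5]|] :=
  boolP [exists v in S, 4 < #|edges_into S (reach e S v)|].
  (* [v] need not be a source, but a source above it has a reach containing that of [v]. *)
  have [s sS vR] := source_above vS.
  apply: (tree_remove_source cS sS) => C HC; have [sC cC _] := comp_facts HC.
  have sub : reach e S v \subset reach e S s.
    by apply: reach_min => //; apply: reach_out_closed.
  have mC : #|edges C| + 5 <= #|edges S|.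
    apply: leq_trans (card_edges_setD sC); rewrite leq_add2l.
    exact: leq_trans m5 (subset_leq_card (edges_intoS (subxx S) sub)).
  apply: tree_depth_leW (IHn _ _ cC); first by rewrite addn3 addn2 !ltnS ltn_divn5.
  by rewrite -ltnS; apply: leq_trans ltn; rewrite ltnS -addn1 (leq_trans _ mC) ?leq_add2l.
move=> /exists_inPn lS'.
have lS : light S by move=> v /lS'; rewrite -leqNgt.
(* Any source will do: its removal costs the third extra level and gives each component the root
   that [tree_depth_light] needs. *)
have [v vS] := set0Pn _ (proj1 cS); have [s sS _] := source_above vS.
apply: (tree_remove_source cS sS) => C HC; have [sC cC _] := comp_facts HC.
have sCS : C \subset S by apply: subset_trans sC (subsetDl _ _).
have [t tC t3] := light_component cS lS (source_sub sS) HC.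
apply: tree_depth_leW (tree_depth_light cC (lightS sCS lS) tC t3).
by rewrite leq_add2r leq_div2r // subset_leq_card ?edgesS.
Qed.

End Elimination.

(* dtd(H) <= floor(l/5) + 3, i.e. H has a DAG elimination forest of depth
   at most floor(l/5) + 3, where l is the number of edges. *)
Theorem mainTheorem10 (V : finType) (e : rel V) :
  dag e ->
  exists F : seq (tree V),
    DAG_elim e [set: V] F /\ fdepth F <= num_edges e %/ 5 + 3.
Proof.
move=> e_dag; apply: forest_of_components => C HC; have [sC cC _] := comp_facts HC.
apply: tree_depth_leW (tree_depth_connected e_dag cC).
rewrite leq_add2r leq_div2r //.
by apply/subset_leq_card/subsetP=> p; rewrite !inE => /and3P[].
Qed.
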